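(* Let $(Q,+,\cdot,\le)$ be an ordered field and $n\ge 2$, and assume $n=2$ or that $(Q,+,\cdot,\le)$ is a Euclidean field. Consider the formulas (using 4 variables) $$\Psi_{\tau\to\sigma}(x,y):=x\neq y\wedge\forall z\big(z=x\vee z=y\vee\exists u\,(u\,\tau\,z\wedge\neg(u\,\tau\,x)\wedge\neg(u\,\tau\,y))\big),$$ $$\Psi_{\tau\to\lambda}(x,y):=\neg\Psi_{\tau\to\sigma}(x,y)\wedge\neg(x\,\tau\,y)\wedge x\neq y.$$ Then in the structure $(Q^n,\tau)$, $\Psi_{\tau\to\sigma}$ defines the relation $\sigma$ and $\Psi_{\tau\to\lambda}$ defines the relation $\lambda$; i.e., for all $a,b\in Q^n$, $\Psi_{\tau\to\sigma}(a,b)$ holds iff $a\,\sigma\,b$, and $\Psi_{\tau\to\lambda}(a,b)$ holds iff $a\,\lambda\,b$.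
   Context: For $p=(p_0,\dots,p_{n-1}),\,q=(q_0,\dots,q_{n-1})\in Q^n$: $p\,\tau\,q$ iff $(p_0-q_0)^2>\sum_{i=1}^{n-1}(p_i-q_i)^2$; $p\,\lambda\,q$ iff $(p_0-q_0)^2=\sum_{i=1}^{n-1}(p_i-q_i)^2$ and $p_0\neq q_0$; $p\,\sigma\,q$ iff $(p_0-q_0)^2<\sum_{i=1}^{n-1}(p_i-q_i)^2$. An ordered field is Euclidean if every nonnegative element is a square. In the formulas, the binary relation symbol $\tau$ is interpreted as the relation $\tau$ and quantifiers range over $Q^n$. *)

(* Defs.v *)
From HB Require Import structures.
From mathcomp Require Import all_boot all_order all_algebra.

Set Implicit Arguments.
Unset Strict Implicit.
Unset Printing Implicit Defensive.

Import Order.TTheory GRing.Theory Num.Theory.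
Local Open Scope ring_scope.

(** First-order formulas with equality over one binary relation symbol, in
    which only the [k] variables ['I_k] (free or bound) may occur. *)
Inductive formula (k : nat) : Type :=
| Eq of 'I_k & 'I_k
| Rel of 'I_k & 'I_k
| Not of formula k
| And of formula k & formula k
| Or of formula k & formula k
| All of 'I_k & formula k
| Ex of 'I_k & formula k.

Definition upd (k : nat) (D : Type) (e : 'I_k -> D) (v : 'I_k) (d : D) :
  'I_k -> D := fun w => if w == v then d else e w.

Fixpoint sat (k : nat) (D : Type) (r : D -> D -> Prop) (e : 'I_k -> D)
    (f : formula k) : Prop :=
  match f with
  | Eq v w => e v = e w
  | Rel v w => r (e v) (e w)
  | Not g => ~ sat r e g
  | And g h => sat r e g /\ sat r e h
  | Or g h => sat r e g \/ sat r e h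
  | All v g => forall d : D, sat r (upd e v d) g
  | Ex v g => exists d : D, sat r (upd e v d) g
  end.

Definition vx : 'I_4 := @Ordinal 4 0 isT.
Definition vy : 'I_4 := @Ordinal 4 1 isT.
Definition vz : 'I_4 := @Ordinal 4 2 isT.
Definition vu : 'I_4 := @Ordinal 4 3 isT.

(** The variables [vz] and [vu] are quantified over but still receive a value
    from the assignment; [defines] requires the equivalence for all of them. *)
Definition defines (D : Type) (r : D -> D -> Prop) (f : formula 4)
    (S : D -> D -> Prop) : Prop :=
  forall (a b : D) (e : 'I_4 -> D), e vx = a -> e vy = b ->
    (sat r e f <-> S a b).

Definition Psi_tau_sigma : formula 4 :=
  And (Not (Eq vx vy))
      (All vz (Or (Eq vz vx)
              (Or (Eq vz vy)
                  (Ex vu (And (Rel vu vz)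
                         (And (Not (Rel vu vx)) (Not (Rel vu vy)))))))).

Definition Psi_tau_lambda : formula 4 :=
  And (Not Psi_tau_sigma) (And (Not (Rel vx vy)) (Not (Eq vx vy))).

(** Points have [n.+1] coordinates, so that the time coordinate [p 0 0]
    (row [0], column [0]) always exists. *)
Section Relations.
Variables (Q : realFieldType) (n : nat).
Implicit Types p q : 'rV[Q]_n.+1.

Definition time2 p q : Q := (p 0 0 - q 0 0) ^+ 2.

Definition space2 p q : Q := \sum_(i < n.+1 | i != 0) (p 0 i - q 0 i) ^+ 2.

Definition tau p q : Prop := time2 p q > space2 p q.

Definition lambda p q : Prop := time2 p q = space2 p q /\ p 0 0 <> q 0 0.

Definition sigma p q : Prop := time2 p q < space2 p q.

End Relations.

Definition euclidean (Q : realFieldType) : Prop :=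
  forall x : Q, 0 <= x -> exists y : Q, x = y ^+ 2.

(* Main.v *)
Require Import Defs.
From HB Require Import structures.
From mathcomp Require Import all_boot all_order all_algebra.
From mathcomp Require Import ring lra.

(** If [a] and [b] are distinct and not spacelike related, their midpoint [z]
    refutes the formula for sigma: the step from [z] to a timelike related [u]
    agrees in time orientation with the causal step from [a] to [z] or with the
    one from [b] to [z], and composing the two steps is timelike.  Conversely,
    if [a] and [b] are spacelike related, the witness [u] lies on the vertical
    line through [z].  The points of this line not timelike related to [a] form
    the interval of center [a_0] and radius the spatial distance from [z] to
    [a], and likewise for [b].  By the triangle inequality these two intervals
    overlap, and their intersection is a single point only if the line passes
    through [a] or [b]; in that case this point differs from [z].  Euclidean
    fields (or a single space dimension) are needed for the radii to exist. *)

Set Implicit Arguments.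
Unset Strict Implicit.
Unset Printing Implicit Defensive.

Import Order.TTheory GRing.Theory Num.Theory.
Local Open Scope ring_scope.

Section SumsOfSquares.
Variables (Q : realFieldType) (I : finType) (P : pred I).
Implicit Types x y : I -> Q.

Lemma sum_sqr_ge0 x : 0 <= \sum_(i | P i) x i ^+ 2.
Proof. by apply: sumr_ge0 => i _; apply: sqr_ge0. Qed.

Lemma sum_sqr_le0 x : \sum_(i | P i) x i ^+ 2 <= 0 -> forall i, P i -> x i = 0.
Proof.
move=> le0 i Pi; have /eqP : \sum_(i | P i) x i ^+ 2 = 0.
  by apply/le_anti; rewrite le0 sum_sqr_ge0.
rewrite psumr_eq0 => [/allP /(_ i (mem_index_enum i))|j _]; last exact: sqr_ge0.
by rewrite Pi sqrf_eq0 => /eqP.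
Qed.

(** Cauchy-Schwarz without square roots: [r] and [s] stand for norms that may not exist in [Q]. For
    positive bounds, expand the nonnegative sum of [(s * x i - r * y i) ^+ 2] and cancel [r * s]; a
    zero bound makes its family vanish. *)
Lemma sum_mul_le x y r s : 0 <= r -> 0 <= s ->
  \sum_(i | P i) x i ^+ 2 <= r ^+ 2 -> \sum_(i | P i) y i ^+ 2 <= s ^+ 2 ->
  \sum_(i | P i) x i * y i <= r * s.
Proof.
rewrite le_eqVlt => /predU1P[<-|r0].
  rewrite expr0n /= => _ /sum_sqr_le0 x0 _.
  by rewrite mul0r big1 // => i Pi; rewrite x0 // mul0r.
rewrite le_eqVlt => /predU1P[<-|s0].
  rewrite expr0n /= => _ /sum_sqr_le0 y0.
  by rewrite mulr0 big1 // => i Pi; rewrite y0 // mulr0.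
move=> xr ys; have := sum_sqr_ge0 (fun i => s * x i - r * y i).
have -> : \sum_(i | P i) (s * x i - r * y i) ^+ 2 =
    s ^+ 2 * (\sum_(i | P i) x i ^+ 2) + r ^+ 2 * (\sum_(i | P i) y i ^+ 2)
    - 2 * (r * s) * (\sum_(i | P i) x i * y i).
  rewrite !mulr_sumr -big_split /= -sumrB.
  by apply: eq_bigr => i _; ring.
have rs0 : 0 < r * s by rewrite mulr_gt0.
have := ler_wpM2l (sqr_ge0 s) xr; have := ler_wpM2l (sqr_ge0 r) ys.
move=> h1 h2 h3; rewrite -(ler_pM2l rs0); nra.
Qed.

Lemma sum_sqrD x y :
  \sum_(i | P i) (x i + y i) ^+ 2 =
  \sum_(i | P i) x i ^+ 2 + \sum_(i | P i) y i ^+ 2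
  + 2 * \sum_(i | P i) x i * y i.
Proof.
rewrite mulr_sumr -!big_split /=.
by apply: eq_bigr => i _; ring.
Qed.

End SumsOfSquares.

Section Minkowski.
Variables (Q : realFieldType) (n : nat).
Implicit Types p q r a b z u : 'rV[Q]_n.+1.

Lemma time2C p q : time2 p q = time2 q p.
Proof. by rewrite /time2 -sqrrN opprB. Qed.

Lemma space2C p q : space2 p q = space2 q p.
Proof. by apply: eq_bigr => i _; rewrite -sqrrN opprB. Qed.

Lemma space2_ge0 p q : 0 <= space2 p q.
Proof. exact: sum_sqr_ge0. Qed.

Lemma space2_split p q r : space2 p r =
  space2 p q + space2 q r
  + 2 * \sum_(i < n.+1 | i != 0) (p 0 i - q 0 i) * (q 0 i - r 0 i).
Proof. by rewrite -sum_sqrD; apply: eq_bigr => i _; rewrite subrKA. Qed.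

Lemma space2_triangle p q r (s t : Q) : 0 <= s -> 0 <= t ->
  space2 p q <= s ^+ 2 -> space2 q r <= t ^+ 2 -> space2 p r <= (s + t) ^+ 2.
Proof.
move=> s0 t0 pq qr; rewrite (space2_split p q r).
have := sum_mul_le s0 t0 pq qr; nra.
Qed.

Lemma eq_of_space2_le0 p q : p 0 0 = q 0 0 -> space2 p q <= 0 -> p = q.
Proof.
move=> pq0 /sum_sqr_le0 pq; apply/rowP => i.
by have [->//|/pq/eqP] := eqVneq i 0; rewrite subr_eq0 => /eqP.
Qed.

(* The sign condition says that the two steps have the same time orientation. *)
Lemma tau_causal p q r : 0 <= (p 0 0 - q 0 0) * (q 0 0 - r 0 0) ->
  tau p q -> space2 q r <= time2 q r -> tau p r.
Proof.
move=> same pq qr; rewrite /tau (space2_split p q r).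
have pq' : space2 p q <= `|p 0 0 - q 0 0| ^+ 2 by rewrite real_normK ?num_real ?ltW.
have qr' : space2 q r <= `|q 0 0 - r 0 0| ^+ 2 by rewrite real_normK ?num_real.
have := sum_mul_le (normr_ge0 _) (normr_ge0 _) pq' qr'.
(* Equal orientation removes the absolute value, so the spatial cross term is at most the temporal
   one. *)
rewrite -normrM ger0_norm //.
move: pq qr; rewrite /tau /time2; nra.
Qed.

Lemma tau_midpoint a b u : space2 a b <= time2 a b ->
  tau u (2^-1 *: (a + b)) -> tau u a \/ tau u b.
Proof.
set z := 2^-1 *: (a + b) => ab uz.
have za i : z 0 i - a 0 i = 2^-1 * (b 0 i - a 0 i) by rewrite !mxE; field.
have zb i : z 0 i - b 0 i = 2^-1 * (a 0 i - b 0 i) by rewrite !mxE; field.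
have ha : space2 z a <= time2 z a.
  rewrite /space2 /time2 za exprMn; under eq_bigr do rewrite za exprMn.
  rewrite -mulr_sumr ler_wpM2l ?sqr_ge0 //.
  by have := ab; rewrite space2C time2C.
have hb : space2 z b <= time2 z b.
  rewrite /space2 /time2 zb exprMn; under eq_bigr do rewrite zb exprMn.
  by rewrite -mulr_sumr ler_wpM2l ?sqr_ge0.
have [h|h] := leP 0 ((u 0 0 - z 0 0) * (z 0 0 - a 0 0)).
  by left; apply: tau_causal uz ha.
(* The steps from [a] and from [b] to the midpoint are opposite, so the orientation that fails for
   [a] holds for [b]. *)
right; apply: tau_causal uz hb; move: h; rewrite za zb; nra.
Qed.

Lemma space2_sqr p q : n.+1 = 2%N \/ euclidean Q ->
  exists2 s : Q, 0 <= s & space2 p q = s ^+ 2.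
Proof.
move=> hQ; have [s pqs] : exists s, space2 p q = s ^+ 2.
  case: hQ => [n1|hQ]; last exact/hQ/space2_ge0.
  case: n1 => n1; rewrite /space2; move: p q; rewrite n1 => p q.
  (* With two coordinates the sum has a single term, at index 1, which is [ord_max]. *)
  exists (p 0 ord_max - q 0 ord_max).
  by apply: big_pred1 => i; case: i => [[|[|]]].
by exists `|s|; rewrite // real_normK ?num_real.
Qed.

Lemma intervals_meet_off (x y r s c : Q) : 0 <= r -> 0 <= s ->
  (x - y) ^+ 2 < (r + s) ^+ 2 -> (r = 0 -> c != x) -> (s = 0 -> c != y) ->
  exists t, [/\ t != c, (t - x) ^+ 2 <= r ^+ 2 & (t - y) ^+ 2 <= s ^+ 2].
Proof.
move=> r0 s0 xy rc sc.
have /andP[xy1 xy2] : - (r + s) < x - y < r + s.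
  by rewrite -ltr_norml -ltr_sqr ?nnegrE ?addr_ge0 // real_normK ?num_real.
have sqr_le (v w : Q) : 0 <= w -> - w <= v <= w -> v ^+ 2 <= w ^+ 2.
  move=> w0; rewrite -ler_norml => vw.
  by rewrite -(real_normK (num_real v)) ler_sqr ?nnegrE.
pose l := Num.max (x - r) (y - s); pose h := Num.min (x + r) (y + s).
have lh : l <= h by rewrite /l /h le_min !ge_max; apply/and3P; split; lra.
have meet t : l <= t <= h -> t != c ->
    exists t, [/\ t != c, (t - x) ^+ 2 <= r ^+ 2 & (t - y) ^+ 2 <= s ^+ 2].
  rewrite /l /h ge_max le_min => /andP[/andP[? ?] /andP[? ?]] tc.
  by exists t; split=> //; apply: sqr_le => //; lra.
have [lc|] := eqVneq l c; last by apply: meet; rewrite lexx.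
have [hc|] := eqVneq h c; last by apply: meet; rewrite lexx lh.
(* Now the intersection is reduced to [c]. If both bounds come from one interval, its radius is zero
   and its center is [c]; if they come from different ones, the centers are at least [r + s]
   apart. *)
have : c <= l /\ h <= c by rewrite lc hc.
rewrite /l /h le_max ge_min => -[].
have r_cases : r = 0 /\ c != x \/ 0 < r by case: ltgtP r0 rc; auto.
have s_cases : s = 0 /\ c != y \/ 0 < s by case: ltgtP s0 sc; auto.
by case/orP=> c1 /orP[] c2; lra.
Qed.

Lemma sigma_witness a b z : n.+1 = 2%N \/ euclidean Q -> sigma a b ->
  z <> a -> z <> b -> exists u, [/\ tau u z, ~ tau u a & ~ tau u b].
Proof.
move=> hQ ab za zb.
have [r r0 zar] := space2_sqr z a hQ; have [s s0 zbs] := space2_sqr z b hQ.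
have : space2 a b <= (r + s) ^+ 2.
  by apply: (space2_triangle (q := z)); rewrite // (space2C a, zbs) ?zar.
move=> /(lt_le_trans ab) xy.
have [||t [tz ta tb]] := intervals_meet_off (c := z 0 0) r0 s0 xy.
(* A zero radius puts [z] on the vertical line through [a], so equal times would give [z = a]. *)
- move=> r00; apply/eqP => za0; apply: za; apply: eq_of_space2_le0 => //.
  by rewrite zar r00 expr0n.
- move=> s00; apply/eqP => zb0; apply: zb; apply: eq_of_space2_le0 => //.
  by rewrite zbs s00 expr0n.
pose u : 'rV[Q]_n.+1 := \row_i (if i == 0 then t else z 0 i).
have ut : u 0 0 = t by rewrite mxE.
have us p : space2 u p = space2 z p.
  by apply: eq_bigr => i /negbTE i0; rewrite mxE i0.
exists u; rewrite /tau !us /time2 ut zar zbs; split; last 2 first.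
- by apply/negP; rewrite -leNgt.
- by apply/negP; rewrite -leNgt.
rewrite (_ : space2 z z = 0); last by apply: big1 => i _; rewrite subrr expr0n.
by rewrite lt_def sqr_ge0 sqrf_eq0 subr_eq0 tz.
Qed.

Lemma sat_tau_sigma (e : 'I_4 -> 'rV[Q]_n.+1) : n.+1 = 2%N \/ euclidean Q ->
  sat (@tau Q n) e Psi_tau_sigma <-> sigma (e vx) (e vy).
Proof.
move=> hQ; rewrite /= /upd /=; set a := e vx; set b := e vy.
split=> [[ab psi]|ab]; last first.
  split=> [eab|z].
    move: ab; rewrite /sigma eab /time2 subrr expr0n /space2 big1 ?ltxx // => i _.
    by rewrite subrr expr0n.
  have [->|/eqP za] := eqVneq z a; first by left.
  have [->|/eqP zb] := eqVneq z b; first by right; left.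
  by right; right; have [u []] := sigma_witness hQ ab za zb; exists u.
rewrite /sigma ltNge; apply/negP => le_ab.
case: (psi (2^-1 *: (a + b))) => [|[|[u [uz [ua ub]]]]].
- move=> /rowP za; apply: ab; apply/rowP => i; have := za i; rewrite !mxE; lra.
- move=> /rowP zb; apply: ab; apply/rowP => i; have := zb i; rewrite !mxE; lra.
- by case: (tau_midpoint le_ab uz).
Qed.

(** Trichotomy of the order gives the equality of squares; under it, equal times force zero spatial
    distance, so distinct points have distinct times. *)
Lemma lambdaE a b : lambda a b <-> ~ sigma a b /\ ~ tau a b /\ a <> b.
Proof.
rewrite /lambda /sigma /tau; split=> [[-> ab0]|[/negP ns [/negP nt ab]]].
  by rewrite ltxx; do 2!split=> //; move=> eab; apply: ab0; rewrite eab.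
have eq_ts : time2 a b = space2 a b by apply/le_anti; rewrite !leNgt ns nt.
split=> // ab0; apply: ab; apply: eq_of_space2_le0 => //.
by rewrite -eq_ts /time2 ab0 subrr expr0n.
Qed.

End Minkowski.

Theorem theorem3p1 (Q : realFieldType) (n : nat) (hn : (2 <= n.+1)%N)
    (hQ : n.+1 = 2%N \/ euclidean Q) :
  defines (@tau Q n) Psi_tau_sigma (@sigma Q n) /\
  defines (@tau Q n) Psi_tau_lambda (@lambda Q n).
Proof.
split=> a b e <- <-; first exact: sat_tau_sigma.
have sgm := sat_tau_sigma e hQ; rewrite lambdaE -sgm; exact: iff_refl.
Qed.
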